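(* Let $X$ be a compact metrizable space and let $A$ be a recursively squashable subset of $X$. Then $A$ is a squashable subset of $X$.
   Context: A decomposition of a topological space $X$ means an upper semi-continuous decomposition: a partition $\mathcal{G}$ of $X$ into compact subsets such that the quotient map $\pi : X \to X/\mathcal{G}$ (with $X/\mathcal{G}$ given the quotient topology) is a closed map. If $X$ is compact metrizable, then so is $X/\mathcal{G}$. A collection $\mathcal{C}$ of subsets of a metric space $(X,\rho)$ is null if for every $\epsilon > 0$ the set $\{C \in \mathcal{C} : \mathrm{diam}_\rho(C) \geq \epsilon\}$ is finite. A null decomposition is a decomposition that is a null collection. Let $X$ be a compact metrizable space with metric $\rho$ (any metric inducing the topology; the notions below do not depend on the choice). $C(X,X)$ denotes the set of continuous maps $X \to X$ with the supremum metric $\bar{\rho}$ determined by $\rho$. For $C \subset X$, $\mathcal{H}_C(X)$ denotes the set of all homeomorphisms $h : X \to X$ with $h|_C = \mathrm{id}_C$, and $\mathrm{cl}(\mathcal{H}_C(X))$ denotes its closure in $C(X,X)$. A subset $A$ of $X$ is squashable if $A$ is compact and for every null decomposition $\mathcal{G}$ of $X$ with $A \in \mathcal{G}$, every open neighborhood $U$ of $A$ in $X$, and every $\delta > 0$, there is a map $f \in \mathrm{cl}(\mathcal{H}_{X-U}(X))$ such that $f(A)$ is a one-point set $\{p\}$, $f$ maps $X - A$ homeomorphically onto $X - \{p\}$, and for every $G \in \mathcal{G}$, either $\mathrm{diam}_\rho(f(G)) < \delta$ or $f|_G = \mathrm{id}_G$. For a compact subset $B$ of $X$, $X/B$ denotes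 the quotient space $X/\mathcal{G}_B$, where $\mathcal{G}_B = \{B\} \cup \{\{x\} : x \in X - B\}$ (that is, $B$ is collapsed to a point); $X/B$ is again compact metrizable. For a compact set $A$ with $B \subset A \subset X$, $A/B$ denotes the image of $A$ under the quotient map $X \to X/B$. A subset $A$ of $X$ is recursively squashable of filtration length $\leq n$ ($n \geq 1$) if there is a finite sequence $A_1 \subset \cdots \subset A_{n+1}$ of compact subsets of $X$ such that $A_1$ is a squashable subset of $X$, $A_i/A_{i-1}$ is a squashable subset of $X/A_{i-1}$ for $2 \leq i \leq n+1$, and $A_{n+1} = A$; filtration length $\leq 0$ means that $A$ itself is squashable. $A$ is recursively squashable if it is recursively squashable of filtration length $\leq n$ for some $n \ge 0$. *)

(* Defs.v *)
From HB Require Import structures.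
From mathcomp Require Import all_boot all_order all_algebra generic_quotient.
From mathcomp Require Import all_classical all_reals.
From mathcomp Require Import ereal topology.

Set Implicit Arguments.
Unset Strict Implicit.
Unset Printing Implicit Defensive.

Import Order.TTheory GRing.Theory Num.Theory.

Local Open Scope classical_set_scope.
Local Open Scope ring_scope.
Local Open Scope quotient_scope.

(* [metricType] bundles one metric with its carrier; here the topology is given
   first (on quotients it is the quotient topology) and several metrics may
   induce it. *)
Record metrizes (R : realType) (X : topologicalType) (rho : X -> X -> R)
    : Prop := Metrizes {
  metrizes_eq0 : forall x y, rho x y = 0 <-> x = y;
  metrizes_sym : forall x y, rho x y = rho y x;
  metrizes_triangle : forall y x z, rho x z <= rho x y + rho y z;
  metrizes_nbhs : forall x : X,
    nbhs x = filter_from [set e : R | 0 < e] (fun e => [set y | rho x y < e])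
}.

Definition metrizable (R : realType) (X : topologicalType) : Prop :=
  exists rho : X -> X -> R, metrizes rho.

(* The diameter is -oo for the empty set and +oo for unbounded sets. *)
Definition diam (R : realType) (X : Type) (rho : X -> X -> R) (C : set X)
    : \bar R :=
  ereal_sup [set (rho x y)%:E | x in C & y in C].

Definition null_collection (R : realType) (X : Type) (rho : X -> X -> R)
    (G : set (set X)) : Prop :=
  forall e : R, 0 < e -> finite_set [set C | G C /\ (e%:E <= diam rho C)%E].

Section quotient_space.
Variables (X : topologicalType) (G : set (set X)).

(* When G is a partition, this says that x and y lie in the same element of G;
   in this form it is an equivalence relation for every collection G. *)
Definition same_class (x y : X) : bool :=
  `[< forall C, G C -> (C x <-> C y) >].

Lemma same_class_refl : reflexive same_class.
Proof. by move=> x; apply/asboolP. Qed.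

Lemma same_class_sym : symmetric same_class.
Proof.
by move=> x y; apply/asboolP/asboolP => xy C GC; apply: iff_sym; exact: xy.
Qed.

Lemma same_class_trans : transitive same_class.
Proof.
move=> y x z /asboolP xy /asboolP yz; apply/asboolP => C GC.
exact: iff_trans (xy C GC) (yz C GC).
Qed.

Definition same_class_equiv : equiv_rel X :=
  EquivRel same_class same_class_refl same_class_sym same_class_trans.

Definition quotient_space : Type := {eq_quot same_class_equiv}.

HB.instance Definition _ := Quotient.on quotient_space.
HB.instance Definition _ :=
  Topological.copy quotient_space (quotient_topology quotient_space).

Definition quotient_map : X -> quotient_space := \pi_quotient_space.

End quotient_space.

Definition closed_map (X Y : topologicalType) (f : X -> Y) : Prop :=
  forall F : set X, closed F -> closed (f @` F).

Definition decomposition (X : topologicalType) (G : set (set X)) : Prop :=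
  [/\ partition G id [set: X], (forall C, G C -> compact C) &
      closed_map (quotient_map G)].

(* If B is empty, the extra element set0 does not affect the quotient, and
   X/B is X. *)
Definition collapse (X : Type) (B : set X) : set (set X) :=
  [set B] `|` [set [set x] | x in ~` B].

Definition homeo_on (X Y : topologicalType) (A : set X) (B : set Y)
    (f : X -> Y) : Prop :=
  [/\ set_bij A B f, {within A, continuous f} &
      exists g : Y -> X,
        {within B, continuous g} /\ forall x, A x -> g (f x) = x].

Definition homeo_fixing (X : topologicalType) (C : set X) : set (X -> X) :=
  [set h | homeo_on [set: X] [set: X] h /\ forall x, C x -> h x = x].

Definition sup_dist (R : realType) (X : Type) (rho : X -> X -> R)
    (f g : X -> X) : \bar R :=
  ereal_sup (range (fun x => (rho (f x) (g x))%:E)).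

(* Closure in the space of continuous self-maps for the supremum metric. *)
Definition closure_sup (R : realType) (X : topologicalType)
    (rho : X -> X -> R) (H : set (X -> X)) : set (X -> X) :=
  [set f | continuous f /\
    forall e : R, 0 < e -> exists2 h, H h & (sup_dist rho f h < e%:E)%E].

Definition squashable_for (R : realType) (X : topologicalType)
    (rho : X -> X -> R) (A : set X) : Prop :=
  compact A /\
  forall (G : set (set X)) (U : set X) (delta : R),
    decomposition G -> null_collection rho G -> G A ->
    open U -> A `<=` U -> 0 < delta ->
    exists f : X -> X,
      [/\ closure_sup rho (homeo_fixing (~` U)) f,
          exists p : X, f @` A = [set p] /\ homeo_on (~` A) (~` [set p]) f &
          forall C, G C ->
            (diam rho (f @` C) < delta%:E)%E \/ (forall x, C x -> f x = x)].

(* On a compact metrizable space the choice of the metric is immaterial. *)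
Definition squashable (R : realType) (X : topologicalType) (A : set X) : Prop :=
  forall rho : X -> X -> R, metrizes rho -> squashable_for rho A.

(* Only A_ 1, ..., A_ n.+1 matter; for n = 0 this reduces to squashable A. *)
Definition filtration_length_le (R : realType) (X : topologicalType) (n : nat)
    (A : set X) : Prop :=
  exists A_ : nat -> set X,
    [/\ (forall i, (1 <= i <= n.+1)%N -> compact (A_ i)),
        (forall i, (1 <= i <= n)%N -> A_ i `<=` A_ i.+1),
        squashable R (A_ 1%N),
        (forall i, (1 <= i <= n)%N ->
          squashable R (quotient_map (collapse (A_ i)) @` A_ i.+1)) &
        A_ n.+1 = A].

Definition recursively_squashable (R : realType) (X : topologicalType)
    (A : set X) : Prop :=
  exists n : nat, filtration_length_le R n A.

(* Main.v *)
Require Import Defs.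
From mathcomp Require Import all_boot all_order all_algebra.
From mathcomp Require Import all_classical all_reals.
From mathcomp Require Import topology.
From mathcomp Require Import generic_quotient ereal lra.

(** Induction along the filtration reduces the theorem to one step
    ([squashable_extension]): if B is squashable in X and A/B is squashable in
    X/B, where B is contained in A, then A is squashable in X.

    Let G be a null decomposition of X with A as an element, and let U and delta
    be given. Breaking A up into B and the points of A - B gives a collection
    which is again a null decomposition ([decomposition_refinement]), because a
    null partition into compact sets is always upper semi-continuous
    ([null_partition_decomposition]). Squashability of B for this decomposition
    gives a limit f1 of homeomorphisms supported in U which collapses exactly B,
    so f1 = phi o q with q : X -> X/B the quotient map and phi : X/B -> X a
    homeomorphism ([collapse_lift]).

    The point of the proof is to measure X/B by the metric which phi pulls back
    from X. Squashability of A/B in X/B, for this metric and for the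
    decomposition by the sets q(C), C in G, gives f2 : X/B -> X/B, and the map
    wanted is f = phi o f2 o q. It collapses exactly A. Writing it as
    (phi o f2 o phi^-1) o f1 presents it as a composite of two limits of
    homeomorphisms fixing X - U, and such limits compose ([closure_sup_comp],
    [closure_sup_conj]). As to the size of f(C): either f2(q(C)) is smaller than
    delta for the pulled back metric, which is to say that f(C) is smaller than
    delta in X; or f2 is the identity on q(C), and then f = f1 on C, where f1
    already makes C small or fixes it. So the same delta serves in both steps.

    Maps which collapse a set are handled through the purely set-theoretic
    predicate [collapses]: for continuous maps between compact Hausdorff spaces
    it already contains the homeomorphism clause ([collapses_homeo_on]), and the
    case of the empty set is that of homeomorphisms ([homeo_onTP]). *)

Set Implicit Arguments.
Unset Strict Implicit.
Unset Printing Implicit Defensive.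

Import Order.TTheory GRing.Theory Num.Theory.

Local Open Scope classical_set_scope.
Local Open Scope ring_scope.

(** * Metrics, diameters and uniform continuity *)

Section suprema.
Context {R : realType} {X : Type} {rho : X -> X -> R}.

Lemma diam_lt_dist (C : set X) (e : R) (x y : X) :
  (diam rho C < e%:E)%E -> C x -> C y -> rho x y < e.
Proof.
move=> Ce Cx Cy; rewrite -lte_fin; apply: le_lt_trans Ce.
by apply: ereal_sup_ubound; exists x => //; exists y.
Qed.

Lemma diam_le (C : set X) (e : R) :
  (forall x y, C x -> C y -> rho x y <= e) -> (diam rho C <= e%:E)%E.
Proof.
move=> Ce; apply: ge_ereal_sup => _ [x Cx [y Cy <-]].
by rewrite lee_fin; exact: Ce.
Qed.

Lemma sup_dist_le (f g : X -> X) (e : R) :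
  (forall x, rho (f x) (g x) <= e) -> (sup_dist rho f g <= e%:E)%E.
Proof.
by move=> fg; apply: ge_ereal_sup => _ [x _ <-]; rewrite lee_fin.
Qed.

Lemma sup_dist_lt (f g : X -> X) (e : R) (x : X) :
  (sup_dist rho f g < e%:E)%E -> rho (f x) (g x) < e.
Proof.
move=> fg; rewrite -lte_fin; apply: le_lt_trans fg.
by apply: ereal_sup_ubound; exists x.
Qed.

End suprema.

Section metric.
Context {R : realType} {X : topologicalType} {rho : X -> X -> R}.
Hypothesis hrho : metrizes rho.

Lemma metrizes_refl (x : X) : rho x x = 0.
Proof. exact/(metrizes_eq0 hrho). Qed.

Lemma metrizes_ge0 (x y : X) : 0 <= rho x y.
Proof.
have := metrizes_triangle hrho y x x.
by rewrite (metrizes_sym hrho y x) metrizes_refl; lra.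
Qed.

Lemma metrizes_ball (x : X) (e : R) : 0 < e -> nbhs x [set y | rho x y < e].
Proof. by move=> e0; rewrite (metrizes_nbhs hrho); exists e. Qed.

Lemma metrizes_small_eq (x y : X) : (forall e, 0 < e -> rho x y < e) -> x = y.
Proof.
move=> small; apply/(metrizes_eq0 hrho); apply/eqP.
rewrite eq_le metrizes_ge0 andbT leNgt; apply/negP => /small.
by rewrite ltxx.
Qed.

Lemma metrizes_hausdorff : hausdorff_space X.
Proof.
move=> x y xy; apply: metrizes_small_eq => e e0.
have e2 : 0 < e / 2 by rewrite divr_gt0.
have [z [/= xz yz]] := xy _ _ (metrizes_ball x e2) (metrizes_ball y e2).
have := metrizes_triangle hrho z x y.
by rewrite (metrizes_sym hrho z y); lra.
Qed.

Lemma unif_continuous_compact (f : X -> X) :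
  compact [set: X] -> continuous f ->
  forall e : R, 0 < e -> exists2 d : R, 0 < d &
    forall x y, rho x y < d -> rho (f x) (f y) < e.
Proof.
move=> /compact_near_coveringP hX cf e e0.
(* F is the filter of all sufficiently small radii; compactness makes a radius
   that is locally uniform in x globally uniform. *)
pose F := filter_from [set d : R | 0 < d] (fun d => [set d' | d' <= d]).
have FF : Filter F.
  apply: filter_from_filter; first by exists 1; rewrite /= ltr01.
  move=> d d' /= d0 d'0; exists (Num.min d d'); first by rewrite /= lt_min d0.
  by move=> c /=; rewrite le_min => /andP[].
have [x _|d d0 dP] := hX _ F
    (fun d x => forall y, rho x y < d -> rho (f x) (f y) < e) FF.
  have e2 : 0 < e / 2 by rewrite divr_gt0.
  have : nbhs x (f @^-1` [set z | rho (f x) z < e / 2]).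
    by apply: cf; exact: metrizes_ball.
  rewrite (metrizes_nbhs hrho) => -[d /= d0 dP].
  have d2 : 0 < d / 2 by rewrite divr_gt0.
  exists ([set y | rho x y < d / 2], [set c | c <= d / 2]).
    by split; [exact: metrizes_ball | exists (d / 2)].
  move=> [y c] /= [xy cd] z yz.
  have xz : rho x z < d by have := metrizes_triangle hrho y x z; lra.
  have fy : rho (f x) (f y) < e / 2 by apply: dP => /=; lra.
  have fz := dP _ xz; rewrite /= in fz.
  have := metrizes_triangle hrho (f x) (f y) (f z).
  by rewrite (metrizes_sym hrho (f y) (f x)); lra.
by exists d => // x y xy; exact: (dP d (lexx d) x I y xy).
Qed.

End metric.

(** * Null partitions are upper semi-continuous *)

Lemma quotient_map_eq (X : topologicalType) (G : set (set X)) (x y : X) :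
  quotient_map G x = quotient_map G y <-> same_class G x y.
Proof.
by split=> [/eqmodP//|xy]; apply/eqmodP.
Qed.

Lemma quotient_map_continuous (X : topologicalType) (G : set (set X)) :
  continuous (quotient_map G).
Proof. exact: pi_continuous. Qed.

Lemma quotient_map_surj (X : topologicalType) (G : set (set X))
  (z : quotient_space G) : exists x, quotient_map G x = z.
Proof. by exists (repr z); exact: reprK. Qed.

(** The saturation of a closed set F is closed: a point x outside of it is at
    some distance r from F, so a class that meets F and comes within r/2 of x
    has diameter at least r/2. There are finitely many of these, all closed and
    none containing x, so a neighborhood of x avoids them. *)
Lemma null_partition_decomposition (R : realType) (X : topologicalType)
    (rho : X -> X -> R) (G : set (set X)) :
  metrizes rho -> partition G id [set: X] ->
  (forall C, G C -> compact C) -> null_collection rho G ->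
  decomposition G.
Proof.
move=> hrho Gpart Gcpt Gnull; split=> // F Fcl.
have [Gcov Gtriv _] := Gpart.
have clG C : G C -> closed C.
  move=> GC; apply: compact_closed (Gcpt _ GC).
  exact: metrizes_hausdorff hrho.
rewrite -openC; apply: (_ : open (quotient_map G @^-1` (~` _))).
rewrite openE => x nFx.
change (nbhs x (quotient_map G @^-1` (~` (quotient_map G @` F)))).
have sat C y : G C -> C x -> C y -> ~ F y.
  move=> GC Cx Cy Fy; apply: nFx; exists y => //.
  apply/quotient_map_eq; apply/asboolP => D GD.
  by split=> [Dy|Dx]; [rewrite (Gtriv D C)// | rewrite (Gtriv D C)//];
    [exists y | exists x].
have nF : ~ F x.
  by move=> Fx; apply: nFx; exists x.
have [r r0 rF] : exists2 r : R, 0 < r & forall y, rho x y < r -> ~ F y.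
  have : nbhs x (~` F) by apply: open_nbhs_nbhs; split=> //; rewrite openC.
  by rewrite (metrizes_nbhs hrho) => -[r]; exists r.
have r2 : 0 < r / 2 by rewrite divr_gt0.
pose BIG := [set C | (G C /\ ((r / 2)%:E <= diam rho C)%E) /\ C `&` F !=set0].
have finBIG : finite_set BIG by apply: sub_finite_set (Gnull _ r2) => C [].
have clBIG : closed (\bigcup_(C in BIG) C).
  by apply: closed_bigcup => // C [[GC _] _]; exact: clG.
have nBIG : nbhs x (~` \bigcup_(C in BIG) C).
  apply: open_nbhs_nbhs; split; first by rewrite openC.
  by move=> [C [[GC _] [y [Cy Fy]]] Cx]; exact: (sat C y).
apply: filterS (filterI nBIG (metrizes_ball hrho x r2)) => y [nBy /= xy] [z Fz].
move=> /quotient_map_eq /asboolP zy.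
have : cover G id y by rewrite Gcov.
move=> [C GC Cy].
have Cz : C z by apply/(zy C GC).
apply: nBy; exists C => //; split; last by exists z.
split=> //; rewrite leNgt; apply/negP => Cr.
have yz := diam_lt_dist Cr Cy Cz.
apply: (rF z) => //.
by have := metrizes_triangle hrho y x z; lra.
Qed.

(** * Collapsing maps *)

(** For [A] empty this says that [f] is a bijection; this is how homeomorphisms
    and maps squashing a set are treated alike. *)
Definition collapses (X Y : Type) (A : set X) (f : X -> Y) : Prop :=
  (forall y, exists x, f x = y) /\
  forall x y, f x = f y <-> x = y \/ (A x /\ A y).

Lemma collapses_quotient_map (X : topologicalType) (B : set X) :
  collapses B (quotient_map (collapse B)).
Proof.
split=> [z|x y]; first exact: quotient_map_surj.
split=> [/quotient_map_eq/asboolP xy|[->//|[Bx By]]].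
  have [Bx|nBx] := pselect (B x).
    by right; split=> //; apply/(xy B) => //; left.
  left; apply/esym; have [|+ _] := xy [set x]; last exact.
  by right; exists x.
apply/quotient_map_eq/asboolP => C [->|[z nBz <-]]; first by split.
by split=> zE; exfalso; apply: nBz; rewrite -zE.
Qed.

Lemma collapses_comp (X Y Z : Type) (B A : set X) (f : X -> Y) (g : Y -> Z) :
  B `<=` A -> collapses B f -> collapses (f @` A) g -> collapses A (g \o f).
Proof.
move=> BA [fs fE] [gs gE]; split=> [z|x y /=].
  by have [y <-] := gs z; have [x <-] := fs y; exists x.
have fA u : (f @` A) (f u) -> A u.
  by move=> [v Av /fE[<-//|[_ /BA]]].
split=> [/gE[/fE[->|[/BA ? /BA ?]]|[/fA ? /fA ?]]|[->//|[Ax Ay]]].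
- by left.
- by right.
- by right.
- by apply/gE; right; split; [exists x | exists y].
Qed.

Lemma collapses_post (X Y Z : Type) (A : set X) (f : X -> Y) (g : Y -> Z) :
  collapses A f -> collapses set0 g -> collapses A (g \o f).
Proof.
move=> [fs fE] [gs gE]; split=> [z|x y /=].
  by have [y <-] := gs z; have [x <-] := fs y; exists x.
by split=> [/gE[/fE//|[]//]|/fE ->].
Qed.

(** Reads off the fibres from the conclusion of squashability; the point [p] is
    forgotten, being the value of [f] on [A]. *)
Lemma collapses_set_bij (X Y : Type) (A : set X) (f : X -> Y) (p : Y) :
  f @` A = [set p] -> set_bij (~` A) (~` [set p]) f -> collapses A f.
Proof.
move=> fA [ff finj fsurj].
have fp x : A x -> f x = p.
  by move=> Ax; have : [set p] (f x) by rewrite -fA; exists x.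
split=> [y|x y].
  have [->|yp] := pselect (y = p).
    by have : (f @` A) p by [rewrite fA]; move=> [x _ <-]; exists x.
  by have [x _ <-] := fsurj y yp; exists x.
split=> [fxy|[->//|[/fp -> /fp ->//]]].
have [Ax|nAx] := pselect (A x); have [Ay|nAy] := pselect (A y).
- by right.
- by exfalso; apply: (ff y nAy) => /=; rewrite -fxy fp.
- by exfalso; apply: (ff x nAx) => /=; rewrite fxy fp.
- by left; apply: finj => //; rewrite inE.
Qed.

Lemma compact_closed_map (X Y : topologicalType) (f : X -> Y) :
  compact [set: X] -> hausdorff_space Y -> continuous f -> closed_map f.
Proof.
move=> hX hY cf F Fcl; apply: compact_closed => //.
apply: continuous_compact; first exact: continuous_subspaceT.
exact: subclosed_compact hX _.
Qed.

(** Over the open set [T] the map [f] is injective, so that a closed set F and a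
    point y of [T] whose preimage is not in F satisfy: y is not in f(F). As f(F)
    is closed, this is continuity of the inverse at y. The inverse has to be a
    total function, which is why [f] is assumed surjective onto all of [Y]. *)
Lemma closed_map_homeo_on (X Y : topologicalType) (f : X -> Y) (T : set Y) :
  continuous f -> closed_map f -> (forall y, exists x, f x = y) -> open T ->
  (forall x y, T (f x) -> f x = f y -> x = y) ->
  homeo_on (f @^-1` T) T f.
Proof.
move=> cf clf fs oT finj; have [g gK] := choice fs.
have gf x : T (f x) -> g (f x) = x by move=> Tx; apply/esym/finj; rewrite ?gK.
split.
- split=> [//|x y /set_mem Tx _|y Ty]; first exact: finj.
  by exists (g y) => //=; rewrite gK.
- exact: continuous_subspaceT.
exists g; split=> //.
rewrite continuous_open_subspace// => y /set_mem Ty V gyV.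
have nFy : ~ (f @` (~` V^°)) y.
  by move=> [x nVx fx]; apply: nVx; rewrite -(gf x) fx.
have : nbhs y (~` (f @` (~` V^°))).
  apply: open_nbhs_nbhs; split=> //; rewrite openC; apply: clf.
  by rewrite closedC; exact: open_interior.
apply: filterS => z nFz; apply: (@interior_subset _ V).
by apply: contrapT => nVz; apply: nFz; exists (g z).
Qed.

(** * Homeomorphisms of compact spaces and their uniform limits *)

Section compact_source.
Context {X : topologicalType}.
Hypothesis hX : compact [set: X].

Lemma collapses_homeo_on (Y : topologicalType) (A : set X) (f : X -> Y) :
  hausdorff_space Y -> A !=set0 -> continuous f -> collapses A f ->
  exists p : Y, f @` A = [set p] /\ homeo_on (~` A) (~` [set p]) f.
Proof.
move=> hY [a Aa] cf [fs fE]; exists (f a); split.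
  apply/seteqP; split=> [_ [x Ax <-]|_ ->]; last by exists a.
  by apply/fE; right.
have -> : ~` A = f @^-1` (~` [set f a]).
  apply/seteqP; split=> x /= nx; last by move=> Ax; apply: nx; apply/fE; right.
  by move=> /fE[xa|[]//]; apply: nx; rewrite xa.
apply: closed_map_homeo_on => //; first exact: compact_closed_map.
  rewrite openC; apply: accessible_closed_set1.
  exact: hausdorff_accessible.
move=> x y /= nx /[dup] fxy /fE[//|[Ax _]].
by exfalso; apply: nx; apply/fE; right.
Qed.

Lemma homeo_onTP (Y : topologicalType) (f : X -> Y) : hausdorff_space Y ->
  homeo_on [set: X] [set: Y] f <-> continuous f /\ collapses set0 f.
Proof.
move=> hY; split=> [[[_ finj fs] cf _]|[cf [fs fE]]].
  split.
    move=> x; rewrite continuous_open_subspace in cf; last exact: openT.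
    by apply: cf; rewrite inE.
  split=> [y|x y]; first by have [x _ <-] := fs y I; exists x.
  by split=> [fxy|[->//|[]//]]; left; apply: finj; rewrite ?inE.
have := @closed_map_homeo_on _ _ f setT cf; rewrite preimage_setT; apply => //.
- exact: compact_closed_map.
- exact: openT.
- by move=> x y _ /fE[//|[]].
Qed.

End compact_source.

Lemma homeo_fixing_comp (X : topologicalType) (C : set X) (f g : X -> X) :
  compact [set: X] -> hausdorff_space X ->
  homeo_fixing C f -> homeo_fixing C g -> homeo_fixing C (g \o f).
Proof.
move=> hX hX2 [/(homeo_onTP hX)-/(_ hX2)[cf bf] fC].
move=> [/(homeo_onTP hX)-/(_ hX2)[cg bg] gC]; split.
  apply/homeo_onTP => //; split; last exact: collapses_post.
  by move=> x; apply: continuous_comp; [exact: cf | exact: cg].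
by move=> x Cx /=; rewrite fC // gC.
Qed.

Section limits_of_homeomorphisms.
Context {R : realType} {X : topologicalType} {rho : X -> X -> R}.
Hypotheses (hX : compact [set: X]) (hrho : metrizes rho).

(** If k is close to g and h is close to f, then k o h is close to g o f: choose
    k first, then h with respect to the modulus of continuity of k. *)
Lemma closure_sup_comp (H : set (X -> X)) (f g : X -> X) :
  (forall h, H h -> continuous h) ->
  (forall h k, H h -> H k -> H (k \o h)) ->
  Defs.closure_sup rho H f -> Defs.closure_sup rho H g ->
  Defs.closure_sup rho H (g \o f).
Proof.
move=> Hc Hcomp [cf fH] [cg gH]; split.
  by move=> x; apply: continuous_comp; [exact: cf | exact: cg].
move=> e e0; have e3 : 0 < e / 3 by rewrite divr_gt0.
have [k Hk gk] := gH _ e3.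
have [d d0 kd] := unif_continuous_compact hrho hX (Hc _ Hk) e3.
have [h Hh fh] := fH _ d0.
exists (k \o h); first exact: Hcomp.
apply: (@le_lt_trans _ _ (e / 3 + e / 3)%:E); last by rewrite lte_fin; lra.
apply: sup_dist_le => x /=.
have := sup_dist_lt (f x) gk; have := kd _ _ (sup_dist_lt x fh).
by have := metrizes_triangle hrho (k (f x)) (g (f x)) (k (h x)); lra.
Qed.

Lemma closure_sup_fixing (C : set X) (f : X -> X) (x : X) :
  Defs.closure_sup rho (homeo_fixing C) f -> C x -> f x = x.
Proof.
move=> [_ fH] Cx; apply: (metrizes_small_eq hrho) => e /fH[h [_ hC]].
by move=> fh; have := sup_dist_lt x fh; rewrite hC.
Qed.

Lemma closure_sup_id (C : set X) : Defs.closure_sup rho (homeo_fixing C) id.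
Proof.
split=> [x //|e e0]; exists id.
  split=> //; apply/homeo_onTP => //; first exact: metrizes_hausdorff hrho.
  by split; [move=> x|split=> [y|x y]; [exists y|split=> [->|[//|[]//]]; left]].
apply: (@le_lt_trans _ _ 0%:E); last by rewrite lte_fin.
by apply: sup_dist_le => x; rewrite (metrizes_refl hrho).
Qed.

(** If f(x) lay outside of U it would be a fixed point of f, hence in the same
    fibre as x; but the only nontrivial fibre is B, which lies inside U. *)
Lemma collapses_preserves_nbhd (B U : set X) (f : X -> X) (x : X) :
  Defs.closure_sup rho (homeo_fixing (~` U)) f -> collapses B f -> B `<=` U ->
  U x -> U (f x).
Proof.
move=> clf [_ fE] BU Ux; apply: contrapT => nUfx.
have /fE[fxx|[/BU//]] := closure_sup_fixing clf nUfx.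
by apply: nUfx; rewrite fxx.
Qed.

End limits_of_homeomorphisms.

(** * The quotient by a collapsed set, measured in the original space *)

Lemma collapse_lift (X Y : topologicalType) (B : set X) (f : X -> Y) :
  continuous f -> collapses B f ->
  exists phi : quotient_space (collapse B) -> Y,
    [/\ continuous phi, collapses set0 phi &
        forall x, phi (quotient_map (collapse B) x) = f x].
Proof.
move=> cf [fs fE]; pose q := quotient_map (collapse B).
have [_ qE] := collapses_quotient_map B.
have phiE x : f (repr (q x)) = f x.
  by apply/fE/qE; exact: reprK.
exists (f \o repr); split=> //.
  apply/quotient_continuous; rewrite (_ : _ \o _ = f) //.
  by apply/funext => x /=; exact: phiE.
split=> [y|z w /=]; first by have [x <-] := fs y; exists (q x); exact: phiE.
have [[x <-] [y <-]] := (quotient_map_surj z, quotient_map_surj w).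
rewrite !phiE; split=> [/fE/qE ->|[/qE/fE//|[]//]]; by left.
Qed.

Section transport.
Context {R : realType} {X Y : topologicalType} {rho : X -> X -> R}.
Context {phi : Y -> X}.
Hypotheses (hX : compact [set: X]) (hY : compact [set: Y]).
Hypotheses (hrho : metrizes rho).
Hypotheses (cphi : continuous phi) (bphi : collapses set0 phi).

Let pullback (y z : Y) : R := rho (phi y) (phi z).

Lemma continuous_inverse :
  exists psi : X -> Y, [/\ continuous psi, cancel phi psi & cancel psi phi].
Proof.
have /(homeo_onTP hY) : hausdorff_space X by exact: metrizes_hausdorff hrho.
move=> /(_ phi)[_ /(_ (conj cphi bphi))[_ _ [psi [cpsi psiK]]]].
exists psi; split=> [x|y|x].
- rewrite continuous_open_subspace in cpsi; last exact: openT.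
  by apply: cpsi; rewrite inE.
- exact: psiK.
- by have [y <-] := bphi.1 x; rewrite psiK.
Qed.

Lemma metrizes_pullback : metrizes pullback.
Proof.
have [psi [cpsi phiK psiK]] := continuous_inverse.
split=> [y z|y z|z y w|y].
- rewrite /pullback; split=> [/(metrizes_eq0 hrho)/(can_inj phiK)//|->].
  exact: metrizes_refl hrho _.
- exact: metrizes_sym hrho _ _.
- exact: metrizes_triangle hrho _ _ _.
apply/seteqP; split=> V /=.
  move=> yV; have : nbhs (phi y) (psi @^-1` V).
    by apply: cpsi; rewrite phiK.
  rewrite (metrizes_nbhs hrho) => -[e e0 eV]; exists e => // z /= /eV /=.
  by rewrite phiK.
move=> [e /= e0 eV]; have : nbhs y (phi @^-1` [set x | rho (phi y) x < e]).
  by apply: cphi; exact: metrizes_ball.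
by apply: filterS.
Qed.

Lemma diam_pullback (C : set Y) : diam pullback C = diam rho (phi @` C).
Proof.
congr ereal_sup; apply/seteqP; split.
  move=> _ [y Cy [z Cz <-]]; exists (phi y); first by exists y.
  by exists (phi z) => //; exists z.
by move=> _ [_ [y Cy <-] [_ [z Cz <-] <-]]; exists y => //; exists z.
Qed.

Lemma closure_sup_conj (C : set X) (psi : X -> Y) (f : Y -> Y) :
  continuous psi -> cancel phi psi -> cancel psi phi ->
  Defs.closure_sup pullback (homeo_fixing (phi @^-1` C)) f ->
  Defs.closure_sup rho (homeo_fixing C) (phi \o f \o psi).
Proof.
move=> cpsi phiK psiK [cf fH].
have cconj (k : Y -> Y) : continuous k -> continuous (phi \o k \o psi).
  move=> ck x; apply: continuous_comp; first exact: cpsi.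
  by apply: continuous_comp; [exact: ck|exact: cphi].
split; first exact: cconj.
have bpsi : collapses set0 psi.
  split=> [y|x y]; first by exists (phi y).
  by split=> [/(can_inj psiK)->|[->//|[]//]]; left.
move=> e /fH[h [hh hC] fh]; exists (phi \o h \o psi); last first.
  apply: le_lt_trans fh; apply: ge_ereal_sup => _ [x _ <-].
  by apply: ereal_sup_ubound; exists (psi x).
have [ch bh] := (homeo_onTP hY h (metrizes_hausdorff metrizes_pullback)).1 hh.
split.
  apply/(homeo_onTP hX); first exact: metrizes_hausdorff hrho.
  split; first exact: cconj.
  by apply: collapses_post => //; apply: collapses_post.
by move=> x Cx /=; rewrite hC /= ?psiK.
Qed.

End transport.

(** * The decompositions used in the two steps *)

Lemma null_collection_image (R : realType) (X Y : Type) (rho : X -> X -> R)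
    (sigma : Y -> Y -> R) (G : set (set X)) (f : X -> Y) :
  (forall e, 0 < e -> exists2 d, 0 < d &
    forall x y, rho x y < d -> sigma (f x) (f y) < e) ->
  null_collection rho G ->
  null_collection sigma [set f @` C | C in G].
Proof.
move=> fu Gnull e e0; have e2 : 0 < e / 2 by rewrite divr_gt0.
have [d d0 fd] := fu _ e2.
apply: sub_finite_set (finite_image (fun C => f @` C) (Gnull _ d0)).
move=> _ [[C GC <-] eC]; exists C => //; split=> //.
rewrite leNgt; apply/negP => Cd.
suff : (diam sigma (f @` C) <= (e / 2)%:E)%E.
  by move=> /(le_trans eC); rewrite lee_fin; lra.
apply: diam_le => _ _ [x Cx <-] [y Cy <-].
by apply: ltW; apply: fd; exact: diam_lt_dist Cd _ _.
Qed.

Section refinement.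
Context {R : realType} {X : topologicalType} {rho : X -> X -> R}.
Hypothesis hrho : metrizes rho.
Variables (G : set (set X)) (A B : set X).
Hypotheses (hG : decomposition G) (Gnull : null_collection rho G) (GA : G A).
Hypotheses (hB : compact B) (B0 : B !=set0) (BA : B `<=` A).

(** [B] has to be an element, so the rest of [A] is broken up into points, which
    have diameter zero and do not affect nullity. All other elements of [G] are
    kept, so that a map squashing [B] for this decomposition controls them. *)
Definition refinement : set (set X) :=
  [set C | [\/ C = B, G C /\ C <> A | exists2 x, (A `\` B) x & C = [set x]]].

Lemma null_refinement : null_collection rho refinement.
Proof.
move=> e e0; have finB : finite_set [set B] by exact: finite_set1.
apply: (@sub_finite_set _ _ ([set B] `|` _) _ _); last first.
  by rewrite finite_setU; split; [exact: finB | exact: (Gnull e0)].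
move=> C [[->|[GC _]|[x _ ->]] eC]; [by left | by right |].
have : (diam rho [set x] <= 0%:E)%E.
  by apply: diam_le => _ _ -> ->; rewrite (metrizes_refl hrho).
by move=> /(le_trans eC); rewrite lee_fin leNgt e0.
Qed.

Lemma partition_refinement : partition refinement id [set: X].
Proof.
have [[Gcov Gtriv G0] _ _] := hG.
have offA C x : G C -> C <> A -> C x -> ~ A x.
  by move=> GC CA Cx Ax; apply: CA; apply: Gtriv => //; exists x.
split.
- rewrite -subTset => x _.
  have [Bx|nBx] := pselect (B x); first by exists B => //; apply: Or31.
  have [Ax|nAx] := pselect (A x).
    by exists [set x] => //; apply: Or33; exists x.
  have : cover G id x by rewrite Gcov.
  move=> [C GC Cx]; exists C => //; apply: Or32; split=> // CA.
  by rewrite -CA in nAx.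
- move=> C D + + [x [Cx Dx]]; rewrite /= in Cx Dx.
  case=> [CB|[GC CA]|[y [Ay nBy] Cy]];
    case=> [DB|[GD DA]|[z [Az nBz] Dz]]; subst.
  + by [].
  + by case: (offA D x) => //; exact: BA.
  + by rewrite Dx in Cx.
  + by case: (offA C x) => //; exact: BA.
  + by apply: Gtriv => //; exists x.
  + by case: (offA C x) => //; rewrite Dx.
  + by rewrite Cx in Dx.
  + by case: (offA D x) => //; rewrite Cx.
  + by rewrite -Cx Dx.
- by move=> C [->//|[/G0//]|[x _ ->]]; exists x.
Qed.

Lemma decomposition_refinement : decomposition refinement.
Proof.
apply: null_partition_decomposition hrho partition_refinement _ null_refinement.
have [_ Gcpt _] := hG.
by move=> C [->//|[/Gcpt//]|[x _ ->]]; exact: compact_set1.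
Qed.

End refinement.

Lemma partition_collapse (X : topologicalType) (G : set (set X)) (A B : set X) :
  partition G id [set: X] -> G A -> B `<=` A ->
  partition [set quotient_map (collapse B) @` C | C in G] id
    [set: quotient_space (collapse B)].
Proof.
move=> [Gcov Gtriv G0] GA BA; have [_ qE] := collapses_quotient_map B.
split.
- rewrite -subTset => z _; have [x <-] := quotient_map_surj z.
  have : cover G id x by rewrite Gcov.
  move=> [C GC Cx]; exists (quotient_map (collapse B) @` C); first by exists C.
  by exists x.
- move=> _ _ [C GC <-] [D GD <-] [_ [[x Cx <-] [y Dy /qE]]] /= xy.
  suff -> : C = D by [].
  case: xy Cx Dy => [<- Cx Dx|[/BA Ay /BA Ax] Cx Dy].
    by apply: Gtriv => //; exists y.
  have -> : C = A by apply: Gtriv => //; exists x.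
  by apply: Gtriv => //; exists y.
- by move=> _ [C /G0[x Cx] <-]; exists (quotient_map (collapse B) x); exists x.
Qed.

(** * Extending squashability from B to A *)

Section extension.
Context {R : realType} {X : topologicalType}.
Hypothesis hX : compact [set: X].

(** The map of the first step. The empty set is never an element of a partition,
    so its squashability carries no information; the identity is used when [B]
    is empty. *)
Lemma collapsing_limit (rho : X -> X -> R) (G : set (set X))
    (A B U : set X) (delta : R) :
  metrizes rho -> squashable R B -> B `<=` A ->
  decomposition G -> null_collection rho G -> G A ->
  open U -> A `<=` U -> 0 < delta ->
  exists f : X -> X,
    [/\ Defs.closure_sup rho (homeo_fixing (~` U)) f, collapses B f &
        forall C, G C -> C <> A ->
          (diam rho (f @` C) < delta%:E)%E \/ (forall x, C x -> f x = x)].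
Proof.
move=> hrho sqB BA hG Gnull GA oU AU delta0.
have [-> |/set0P B0] := eqVneq B set0.
  exists id; split.
  - exact: closure_sup_id.
  - by split=> [x|x y]; [exists x|split=> [->|[//|[]//]]; left].
  - by right.
have [cB sq] := sqB rho hrho.
have [] := sq _ U delta (decomposition_refinement hrho hG Gnull GA cB B0 BA)
  (null_refinement hrho A B Gnull) _ oU _ delta0.
- exact: Or31.
- exact: subset_trans AU.
move=> f [clf [p [fB [fbij _ _]]] fsmall].
exists f; split=> //; first exact: collapses_set_bij fB fbij.
by move=> C GC CA; apply: fsmall; apply: Or32.
Qed.

(** With q : X -> X/B and phi : X/B -> X the homeomorphism induced by a map f1
    squashing B, the map phi o f2 o q squashes A as soon as f2 squashes A/B, and
    its control is the one of f2 for the metric pulled back along phi. *)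
Lemma squashable_extension (A B : set X) :
  compact A -> B `<=` A -> squashable R B ->
  squashable R (quotient_map (collapse B) @` A) ->
  squashable R A.
Proof.
move=> cA BA sqB sqAB rho hrho; split=> // G U delta hG Gnull GA oU AU delta0.
have [Gpart Gcpt _] := hG.
have A0 : A !=set0 by have [_ _] := Gpart; exact.
have hX2 : hausdorff_space X := metrizes_hausdorff hrho.
pose q := quotient_map (collapse B).
have [f1 [clf1 bf1 f1small]] :=
  collapsing_limit hrho sqB BA hG Gnull GA oU AU delta0.
have cf1 := clf1.1.
have [phi [cphi bphi phiq]] := collapse_lift cf1 bf1.
have hQ : compact [set: quotient_space (collapse B)].
  rewrite (_ : setT = q @` setT).
    apply: continuous_compact => //; apply: continuous_subspaceT.
    exact: quotient_map_continuous.
  apply/esym; rewrite -subTset => z _.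
  by have [x <-] := quotient_map_surj z; exists x.
have [psi [cpsi phiK psiK]] := continuous_inverse hQ hrho cphi bphi.
have hsigma := metrizes_pullback hQ hrho cphi bphi.
set sigma := (fun y z => _) in hsigma.
(* q(C) has the size of f1(C), which is controlled by that of C. *)
have Hnull : null_collection sigma [set q @` C | C in G].
  apply: null_collection_image Gnull => e e0.
  have [d d0 fd] := unif_continuous_compact hrho hX cf1 e0.
  by exists d => // x y xy; rewrite /sigma !phiq; exact: fd.
have Hdec : decomposition [set q @` C | C in G].
  apply: null_partition_decomposition hsigma _ _ Hnull.
    exact: partition_collapse GA BA.
  move=> _ [C GC <-]; apply: continuous_compact; last exact: Gcpt.
  by apply: continuous_subspaceT; exact: quotient_map_continuous.
have oV : open (phi @^-1` U) by move/continuousP: cphi; exact.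
have AV : q @` A `<=` phi @^-1` U.
  move=> _ [x Ax <-] /=; rewrite phiq.
  apply: (collapses_preserves_nbhd hrho clf1 bf1); last exact: AU.
  exact: subset_trans AU.
have [_ sq] := sqAB sigma hsigma.
have HA : [set q @` C | C in G] (q @` A) by exists A.
have [f2 [clf2 [p [f2A [f2bij _ _]]] f2small]] :=
  sq _ _ _ Hdec Hnull HA oV AV delta0.
pose f := phi \o f2 \o q.
have fE : f = (phi \o f2 \o psi) \o f1.
  by apply/funext => x; rewrite /f /= -phiq phiK.
have clf : Defs.closure_sup rho (homeo_fixing (~` U)) f.
  rewrite fE; apply: (closure_sup_comp hX hrho) clf1 _.
  - by move=> h [/(homeo_onTP hX)-/(_ hX2)[]].
  - by move=> h k; exact: homeo_fixing_comp.
  - by apply: closure_sup_conj.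
have bf : collapses A f.
  apply: (collapses_post (f := f2 \o q)) bphi.
  apply: collapses_comp BA (collapses_quotient_map B) _.
  exact: collapses_set_bij f2A f2bij.
have fq C : f @` C = phi @` (f2 @` (q @` C)) by rewrite !image_comp.
exists f; split=> //.
  by apply: collapses_homeo_on => //; exact: clf.1.
move=> C GC.
(* f1 has no control on A itself, but f(A) is a point. *)
have [->|CA] := pselect (C = A).
  left; rewrite fq f2A image_set1.
  apply: (@le_lt_trans _ _ 0%:E); last by rewrite lte_fin.
  by apply: diam_le => _ _ -> ->; rewrite (metrizes_refl hrho).
have HC : [set q @` C | C in G] (q @` C) by exists C.
have [|f2C] := f2small (q @` C) HC.
  by rewrite (diam_pullback (rho := rho) (phi := phi)) -fq; left.
have fC z : C z -> f z = f1 z.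
  by move=> Cz; rewrite /f /= f2C ?phiq//; exists z.
have [f1C|f1C] := f1small C GC CA; [left | right].
  rewrite (_ : f @` C = f1 @` C) //.
  by apply/seteqP; split=> _ [z Cz <-]; exists z; rewrite ?fC.
by move=> z Cz; rewrite fC ?f1C.
Qed.

End extension.

Theorem theorem4 (R : realType) (X : topologicalType) (A : set X)
    (hX : compact [set: X]) (hm : metrizable R X)
    (hA : recursively_squashable R A) :
  squashable R A.
Proof.
have [n [A_ [cA incA sq1 sqS <-]]] := hA.
suff sq i : (1 <= i <= n.+1)%N -> squashable R (A_ i).
  by apply: sq; rewrite leqnn.
elim: i => [//|[|i] IH] iP //.
have in' : (1 <= i.+1 <= n)%N by [].
apply: (squashable_extension hX (cA _ iP) (incA _ in')) (sqS _ in').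
by apply: IH; exact: leqW.
Qed.
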